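(* Let $q\in\mathbb{N}$ with $q\ge 2$ and, for all $n\in\mathbb{N}$, put $$a_n=\left\lfloor\frac{qn-1}{q-1}\right\rfloor,\qquad b_n=qn.$$ Define the invariant subtraction game $G$ by $\mathcal{M}(G)=\{\{a_n,b_n\}\mid n\in\mathbb{N}\}$. Then $$\mathcal{P}(G)=S\cup\{\{0,x\}\mid x\in\mathbb{N}_0\},$$ where $$S=\{(qn+s,\,qn+t)\mid s,t\in\{1,2,\dots,q-1\},\ n\in\mathbb{N}_0\}.$$
   Context: $\mathbb{N}=\{1,2,3,\dots\}$, $\mathbb{N}_0=\{0,1,2,\dots\}$. Symmetric notation: inside sets of positions or moves, $\{x,y\}$ stands for both ordered pairs $(x,y)$ and $(y,x)$. An invariant subtraction game $G$ on $\mathbb{N}_0\times\mathbb{N}_0$ is given by a set of moves $\mathcal{M}(G)\subseteq(\mathbb{N}_0\times\mathbb{N}_0)\setminus\{(0,0)\}$; from position $(x,y)$ the options are all $(x-i,y-j)$ with $(i,j)\in\mathcal{M}(G)$, $i\le x$, $j\le y$. Two players alternate and a player who cannot move loses. A position is $P$ if all its options are $N$ (in particular if it has no options) and is $N$ if it has at least one $P$ option; $\mathcal{P}(G)$ is the set of $P$-positions. *)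

(* Defs.v *)
From mathcomp Require Import all_boot.
From mathcomp Require Import classical_sets.

Set Implicit Arguments.
Unset Strict Implicit.
Unset Printing Implicit Defensive.

Local Open Scope classical_set_scope.
Local Open Scope nat_scope.

Record invariant_game := InvariantGame {
  moves : set (nat * nat);
  moves_neq0 : ~ moves (0, 0) }.

Definition options (G : invariant_game) (p : nat * nat) : set (nat * nat) :=
  [set o | exists i j : nat,
     [/\ moves G (i, j), i <= p.1, j <= p.2 & o = (p.1 - i, p.2 - j)]].

(* Every move strictly decreases the sum of the coordinates, so this inductive
   definition is a recursion on positions: each position is in exactly one of
   the two classes. *)
Inductive P_position (G : invariant_game) : nat * nat -> Prop :=
| P_intro p : (forall o, options G p o -> N_position G o) -> P_position G p
with N_position (G : invariant_game) : nat * nat -> Prop :=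
| N_intro p o : options G p o -> P_position G o -> N_position G p.

Definition P_positions (G : invariant_game) : set (nat * nat) :=
  [set p | P_position G p].

(* Entries {x, y} of a set of positions or moves stand for both (x, y) and
   (y, x). *)
Definition sym (A : set (nat * nat)) : set (nat * nat) :=
  A `|` [set (p.2, p.1) | p in A].

(* For q >= 2 and n >= 1 no subtraction is truncated and no divisor is 0. *)
Definition a_ (q n : nat) : nat := (q * n - 1) %/ (q - 1).

Definition b_ (q n : nat) : nat := q * n.

Definition ab_moves (q : nat) : set (nat * nat) :=
  sym [set (a_ q n, b_ q n) | n in [set n : nat | 1 <= n]].

Lemma ab_moves_neq0 (q : nat) : 2 <= q -> ~ ab_moves q (0, 0).
Proof.
move=> q2 [[n /= n1 [_ /eqP]]|[p [n /= n1 <-] [/eqP]]];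
  by rewrite /b_ muln_eq0 => /orP[] /eqP e; rewrite e in q2 n1.
Qed.

Definition ab_game (q : nat) (hq : 2 <= q) : invariant_game :=
  InvariantGame (ab_moves_neq0 hq).

Definition S_ (q : nat) : set (nat * nat) :=
  [set p | exists n s t : nat,
     [/\ 1 <= s <= q - 1, 1 <= t <= q - 1 & p = (q * n + s, q * n + t)]].

(* Main.v *)
Require Import Defs.
From mathcomp Require Import all_boot.
From mathcomp Require Import classical_sets.
From mathcomp Require Import boolp zify.

(** The set of P-positions is the unique kernel of the option relation
([P_positions_kernel]), so it suffices to show that the claimed set [T] is
independent (no move joins two of its elements) and absorbing (every position
outside [T] has an option in [T]).

Writing [n = (q - 1) * k + s] with [1 <= s < q] gives [a_n = q * k + s] and
[b_n = q * ((q - 1) * k + s)] ([ab_movesE]): the [a_n] are the positive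
integers that [q] does not divide, and the [b_n] are its positive multiples.

Independence: a position on an axis has no option, since the entries of a move
are positive.  From [(q * n + s, q * n + t)] in [S], the entry [b_m] cannot
empty a coordinate, for [q] does not divide that coordinate; the entry [a_m]
can only do so when [b_m] is too large for the other one.  Staying in [S] needs
the quotients of the two coordinates by [q] to drop by the same amount; the
drop is [m = (q - 1) * k + s'] on one side and [k] or [k + 1] on the other.
As [m >= k + s'], this forces [s' = 1] and a borrow in the subtraction of [s']
from a residue at least [1], which is absurd.

Absorption: let [x = q * X + s] and [y = q * Y + t] with [X <= Y], both
positive.  If [x] or [y] is a multiple of [q], or if [y] is large, one
coordinate can be emptied.  Otherwise [Y - X > 0] and [q > 2]; the difference
[Y - X] must be cancelled by a move into [S], and dividing [Y - X - 1] by
[q - 2] gives the index of such a move ([absorbing_le]). *)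

Local Open Scope classical_set_scope.
Local Open Scope nat_scope.

(** * P-positions as the kernel of the option relation *)

Lemma options_sum_lt (G : invariant_game) (p o : nat * nat) :
  options G p o -> o.1 + o.2 < p.1 + p.2.
Proof.
case=> i [j [Gij ip jp ->]] /=.
have : ~ (i = 0 /\ j = 0).
  by case=> i0 j0; apply: (@moves_neq0 G); rewrite -{1}i0 -j0.
lia.
Qed.

Lemma P_not_N (G : invariant_game) (p : nat * nat) :
  P_position G p -> ~ N_position G p.
Proof.
have [n] := ubnP (p.1 + p.2); elim: n p => // n IHn p ltpn Pp Np.
case: Np Pp ltpn => {}p o Gpo Po Pp ltpn.
case: Pp Gpo ltpn => {}p optN Gpo ltpn.
apply: (IHn o) Po (optN o Gpo).
by have := options_sum_lt _ _ _ Gpo; lia.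
Qed.

Lemma P_positions_kernel (G : invariant_game) (T : set (nat * nat)) :
  (forall p o, T p -> options G p o -> ~ T o) ->
  (forall p, ~ T p -> exists2 o, options G p o & T o) ->
  P_positions G = T.
Proof.
move=> indep absorb.
have TPN p : (T p -> P_position G p) /\ (~ T p -> N_position G p).
  have [n] := ubnP (p.1 + p.2); elim: n p => // n IHn p ltpn.
  split=> [Tp|/absorb[o Gpo To]].
    apply: P_intro => o Gpo.
    have lton := options_sum_lt _ _ _ Gpo.
    by apply: (IHn o _).2 (indep _ _ Tp Gpo); lia.
  have lton := options_sum_lt _ _ _ Gpo.
  by apply: N_intro Gpo ((IHn o _).1 To); lia.
apply/seteqP; split=> p; last exact: (TPN p).1.
move=> Pp; apply: contrapT => /(TPN p).2.
exact: P_not_N.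
Qed.

(** * Moves and positions in explicit form *)

Lemma a_E (q k s : nat) : 1 <= s <= q - 1 ->
  a_ q ((q - 1) * k + s) = q * k + s.
Proof.
move=> s_bd; rewrite /a_.
have -> : q * ((q - 1) * k + s) - 1 = (q * k + s) * (q - 1) + (s - 1).
  case: q s_bd => [|r]; first lia.
  case: s => [|s]; first lia.
  by rewrite !subn1 /=; nia.
by rewrite divnMDl ?divn_small; lia.
Qed.

Lemma ab_movesE (q i j : nat) : 2 <= q ->
  ab_moves q (i, j) <->
  exists k s, 1 <= s <= q - 1 /\
    (i = q * k + s /\ j = q * ((q - 1) * k + s) \/
     j = q * k + s /\ i = q * ((q - 1) * k + s)).
Proof.
move=> q2; split.
  have decomp n : 1 <= n ->
      exists k s, 1 <= s <= q - 1 /\ n = (q - 1) * k + s.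
    (* The residue is taken in 1..q-1 rather than 0..q-2, hence n - 1. *)
    move=> n1; exists ((n - 1) %/ (q - 1)), ((n - 1) %% (q - 1)).+1.
    have := divn_eq (n - 1) (q - 1).
    have : (n - 1) %% (q - 1) < q - 1 by rewrite ltn_mod; lia.
    by rewrite mulnC; lia.
  case=> [[n /= n1 [<- <-]]|[_ [n /= n1 <-] [/= <- <-]]];
    have [k [s [s_bd ->]]] := decomp n n1; exists k, s;
    by rewrite a_E //; split=> //; first [by left | by right].
case=> k [s [s_bd ij]].
have m1 : 1 <= (q - 1) * k + s.
  by case/andP: s_bd => s1 _; rewrite addn_gt0 s1 orbT.
case: ij => -[-> ->]; [left | right].
  by exists ((q - 1) * k + s) => //=; rewrite a_E.
exists (q * k + s, q * ((q - 1) * k + s)) => //.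
by exists ((q - 1) * k + s) => //=; rewrite a_E.
Qed.

Lemma ab_optionP (q : nat) (hq : 2 <= q) (x y u v k s : nat) :
  1 <= s <= q - 1 -> x = u + (q * k + s) -> y = v + q * ((q - 1) * k + s) ->
  options (ab_game hq) (x, y) (u, v).
Proof.
move=> s_bd -> ->; exists (q * k + s), (q * ((q - 1) * k + s)).
split; rewrite /= ?leq_addl ?addnK //.
by apply/ab_movesE => //; exists k, s; split=> //; left.
Qed.

Lemma ab_options_swap (q : nat) (hq : 2 <= q) (x y u v : nat) :
  options (ab_game hq) (x, y) (u, v) -> options (ab_game hq) (y, x) (v, u).
Proof.
case=> i [j [/ab_movesE[//|k [s [s_bd ij]]] ix jy [-> ->]]].
exists j, i; split=> //; apply/ab_movesE => //.
by exists k, s; split=> //; case: ij; [right | left].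
Qed.

(** The claimed set of P-positions. *)
Definition target (q : nat) : set (nat * nat) :=
  S_ q `|` sym [set (0, x) | x in [set: nat]].

Lemma targetE (q x y : nat) :
  target q (x, y) <->
  [\/ x = 0, y = 0 |
    exists n s t, [/\ 1 <= s <= q - 1, 1 <= t <= q - 1,
                      x = q * n + s & y = q * n + t]].
Proof.
split.
  case=> [[n [s [t [s_bd t_bd [-> ->]]]]]|].
    by apply: Or33; exists n, s, t.
  case=> [[z _ [<- _]]|[_ [z _ <-] [_ <-]]]; first exact: Or31.
  exact: Or32.
case=> [->|->|[n [s [t [s_bd t_bd -> ->]]]]].
- by right; left; exists y.
- by right; right; exists (0, x) => //; exists x.
- by left; exists n, s, t.
Qed.

Lemma target_swap (q x y : nat) : target q (x, y) -> target q (y, x).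
Proof.
move/targetE => T; apply/targetE.
case: T => [->|->|[n [s [t [s_bd t_bd -> ->]]]]]; [exact: Or32|exact: Or31|].
by apply: Or33; exists n, t, s.
Qed.

(** * Independence *)

(** A move whose entry [b_m] is taken from the second coordinate does not join
two elements of [target q]. *)
Lemma target_independent_ab (q u v k s : nat) : 2 <= q -> 1 <= s <= q - 1 ->
  target q (u + (q * k + s), v + q * ((q - 1) * k + s)) -> ~ target q (u, v).
Proof.
move=> q2 s_bd /targetE T /targetE T'.
have m_gt : k + s <= (q - 1) * k + s by nia.
have {T} [n [s1 [t1 [s1_bd t1_bd xE yE]]]] : exists n s1 t1,
    [/\ 1 <= s1 <= q - 1, 1 <= t1 <= q - 1,
        u + (q * k + s) = q * n + s1 &
        v + q * ((q - 1) * k + s) = q * n + t1].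
  by case: T => [|e|//]; [lia | nia].
have ltmn : (q - 1) * k + s <= n by nia.
case: T' => [u0|v0|[n' [s2 [t2 [s2_bd t2_bd uE vE]]]]].
- have kn : k = n by nia.
  lia.
- by move: ((q - 1) * k + s) m_gt ltmn yE => m m_gt ltmn yE; nia.
- have nE : n = n' + ((q - 1) * k + s).
    by move: ((q - 1) * k + s) m_gt ltmn yE => m m_gt ltmn yE; nia.
  (* The first coordinate drops by m = (q - 1) * k + s in its quotient, which
     is possible only if m = k + 1, with a borrow, and then s = 1. *)
  have mE : (q - 1) * k + s = k.+1.
    by move: ((q - 1) * k + s) m_gt ltmn yE nE => m m_gt ltmn yE nE; nia.
  by rewrite mE in nE; nia.
Qed.

Lemma target_independent (q : nat) (hq : 2 <= q) (p o : nat * nat) :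
  target q p -> options (ab_game hq) p o -> ~ target q o.
Proof.
case: p => x y Txy [i [j [/ab_movesE[//|k [s [s_bd ij]]] /= ix jy ->]]] To.
case: ij => -[iE jE].
  apply: (@target_independent_ab q (x - i) (y - j) k s) To => //.
  by rewrite -iE -jE !subnK.
apply: (@target_independent_ab q (y - j) (x - i) k s) (target_swap _ _ _ To)
  => //.
by rewrite -iE -jE !subnK //; apply: target_swap.
Qed.

(** * Absorption *)

(** If the second coordinate is a positive multiple of [q] and the first one is
at least the matching [a_m], then the second one can be emptied. *)
Lemma empty_multiple (q : nat) (hq : 2 <= q) (x Y : nat) :
  0 < Y -> a_ q Y <= x ->
  exists2 o, options (ab_game hq) (x, q * Y) o & target q o.
Proof.
move=> Y0 ax; exists (x - a_ q Y, 0); last by apply/targetE; apply: Or32.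
exists (a_ q Y), (q * Y); split; rewrite /= ?subnn //.
by left; exists Y.
Qed.

Lemma a_le_b (q n : nat) : a_ q n <= q * n.
Proof. by apply: leq_trans (leq_div _ _) (leq_subr _ _). Qed.

Lemma a_homo (q m n : nat) : m <= n -> a_ q m <= a_ q n.
Proof.
by move=> mn; rewrite /a_ leq_div2r // leq_sub2r // leq_mul2l mn orbT.
Qed.

Lemma absorbing_le (q : nat) (hq : 2 <= q) (x y : nat) :
  x %/ q <= y %/ q -> ~ target q (x, y) ->
  exists2 o, options (ab_game hq) (x, y) o & target q o.
Proof.
have q0 : 0 < q by lia.
set X := x %/ q; set Y := y %/ q; set s := x %% q; set t := y %% q.
have xE : x = q * X + s by rewrite mulnC -divn_eq.
have yE : y = q * Y + t by rewrite mulnC -divn_eq.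
have ltsq : s < q by rewrite ltn_mod.
have lttq : t < q by rewrite ltn_mod.
move: X Y s t xE yE ltsq lttq => X Y s t xE yE ltsq lttq XY nT.
have x0 : 0 < x by rewrite lt0n; apply/eqP => e; apply/nT/targetE/Or31.
have y0 : 0 < y by rewrite lt0n; apply/eqP => e; apply/nT/targetE/Or32.
have XYst : 0 < s -> 0 < t -> X < Y.
  move=> s0 t0; rewrite ltn_neqAle XY andbT; apply/eqP => e.
  by apply/nT/targetE/Or33; exists X, s, t; split; lia.
have [s0|s0] := posnP s.
  have X0 : 0 < X by lia.
  have ay : a_ q X <= y.
    by apply: leq_trans (a_le_b q X) _; rewrite yE; nia.
  have [[u v] Go To] := empty_multiple q hq y X X0 ay.
  exists (v, u); last exact: target_swap.
  by rewrite xE s0 addn0; apply: ab_options_swap.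
pose m := (q - 1) * X + s.
have [mY|Ym] := leqP m Y.
  (* Here x = a_m, and b_m <= y. *)
  exists (0, y - q * m); last by apply/targetE/Or31.
  apply: (@ab_optionP _ _ _ _ _ _ X s) => //; first lia.
  by rewrite subnK // yE; nia.
have [t0|t0] := posnP t.
  rewrite yE t0 addn0; apply: empty_multiple; first lia.
  apply: leq_trans (a_homo q Y m (ltnW Ym)) _.
  by rewrite /m a_E ?xE //; lia.
have ltXY := XYst s0 t0.
have q3 : 3 <= q by move: Ym; rewrite /m; nia.
(* The difference Y - X = (q - 2) * k + r, with r in 1..q-2, is cancelled by
   the move of index (q - 1) * k + s', where s' = r if r < s, and s' = r + 1 if
   not: in the latter case the subtraction of s' from s borrows one q. *)
pose k := (Y - X - 1) %/ (q - 2); pose r := ((Y - X - 1) %% (q - 2)).+1.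
have DE : Y - X = (q - 2) * k + r.
  by have := divn_eq (Y - X - 1) (q - 2); rewrite mulnC /k /r; lia.
have r_bd : 1 <= r <= q - 2 by rewrite /r /= ltn_mod; lia.
move: k r DE r_bd => k r DE r_bd.
have mulE : (q - 1) * k = (q - 2) * k + k by nia.
have DltX : (q - 2) * k + r < (q - 2) * X + s by move: Ym; rewrite /m; nia.
have [rs|sr] := ltnP r s.
  have kX : k <= X by nia.
  exists (q * (X - k) + (s - r), q * (X - k) + t).
    apply: (@ab_optionP _ _ _ _ _ _ k r); [lia | nia |].
    have -> : (q - 1) * k + r = Y - X + k by lia.
    nia.
  by apply/targetE/Or33; exists (X - k), (s - r), t; split; lia.
have kX : k < X by nia.
exists (q * (X - k.+1) + (q + s - r.+1), q * (X - k.+1) + t).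
  apply: (@ab_optionP _ _ _ _ _ _ k r.+1); [lia | nia |].
  have -> : (q - 1) * k + r.+1 = Y - X + k.+1 by lia.
  nia.
by apply/targetE/Or33; exists (X - k.+1), (q + s - r.+1), t; split; lia.
Qed.

Lemma target_absorbing (q : nat) (hq : 2 <= q) (p : nat * nat) :
  ~ target q p -> exists2 o, options (ab_game hq) p o & target q o.
Proof.
case: p => x y nT.
have [XY|YX] := leqP (x %/ q) (y %/ q); first exact: absorbing_le.
have nT' : ~ target q (y, x) by move/target_swap.
have [[u v] Go To] := absorbing_le q hq y x (ltnW YX) nT'.
by exists (v, u); [exact: ab_options_swap | exact: target_swap].
Qed.

Theorem theorem6 (q : nat) (hq : 2 <= q) :
  P_positions (ab_game hq) =
  S_ q `|` sym [set (0, x) | x in [set: nat]].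
Proof.
apply: (@P_positions_kernel _ (target q)).
- exact: target_independent.
- exact: target_absorbing.
Qed.
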